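(* Let $A$ be a Jordan subalgebra of $E$, $B$ a given $A$-complement of $E$ with the associated canonical matched pair of Jordan algebras $(A, B, \triangleright, \triangleleft)$. Then $\overline{B}$ is an $A$-complement of $E$ if and only if there exists an isomorphism of Jordan algebras $\overline{B} \cong B_{r}$, for some deformation map $r : B \to A$ of the matched pair $(A, B, \triangleright, \triangleleft)$.
   Context: Throughout, $k$ is a field of characteristic $\neq 2$ and all vector spaces and (bi)linear maps are over $k$. A Jordan algebra is a vector space $A$ with a bilinear multiplication (written by juxtaposition) which is commutative, $ab=ba$, and satisfies the Jordan identity $(a^2 b)a = a^2(ba)$ for all $a,b\in A$ (no unit is required). In the claim, $E$ and $\overline{B}$ are Jordan algebras. Let $A$ be a Jordan subalgebra of a Jordan algebra $E$. An $A$-complement of $E$ is a Jordan subalgebra $B$ of $E$ with $E=A+B$ and $A\cap B=\{0\}$. The canonical matched pair $(A,B,\triangleright,\triangleleft)$ associated to an $A$-complement $B$ of $E$ consists of the bilinear maps $\triangleright : B\times A\to A$ and $\triangleleft : B\times A\to B$ determined by the unique decomposition in $E=A\oplus B$: $$ba = b\triangleright a + b\triangleleft a,\qquad b\triangleright a\in A,\ b\triangleleft a\in B,\qquad a\in A,\ b\in B.$$ A deformation map of $(A,B,\triangleright,\triangleleft)$ is a $k$-linear map $r:B\to A$ such that for all $x,y\in B$: $$r(x y) - r(x) r(y) = x \triangleright r(y) + y \triangleright r(x) - r\bigl( x \triangleleft r(y) + y \triangleleft r(x) \bigr).$$ For a deformation map $r$, the $r$-deformation $B_r$ of $B$ is the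 vector space $B$ with the multiplication $x \cdot_{r} y := x y + x \triangleleft r(y) + y \triangleleft r(x)$ for all $x,y\in B$; it is a Jordan algebra. *)

(* Defs.v *)
From HB Require Import structures.
From mathcomp Require Import all_boot all_order all_algebra.
Set Implicit Arguments.
Unset Strict Implicit.
Unset Printing Implicit Defensive.
Import GRing.Theory.
Local Open Scope ring_scope.

Reserved Notation "x ** y" (at level 40, left associativity).
Reserved Notation "J ~=j K" (at level 70).

HB.mixin Record isJordan (k : fieldType) J of GRing.Lmodule k J := {
  jmul : J -> J -> J;
  jmul_bilinear : bilinear_for *:%R *:%R jmul;
  jmulC : commutative jmul;
  jmul_jordan : forall a b : J,
    jmul (jmul (jmul a a) b) a = jmul (jmul a a) (jmul b a)
}.

#[short(type="jordanType")]
HB.structure Definition Jordan (k : fieldType) :=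
  {J of GRing.Lmodule k J & isJordan k J}.

Notation "x ** y" := (jmul x y) : ring_scope.

HB.instance Definition _ (k : fieldType) (J : jordanType k) :=
  bilinear_isBilinear.Build k J J J *:%R *:%R (@jmul k J) jmul_bilinear.

Section JordanTheory.
Variables (k : fieldType) (J : jordanType k).
Implicit Types x y z : J.

Lemma jmulDl x y z : (x + y) ** z = x ** z + y ** z.
Proof. exact: linearDl. Qed.

Lemma jmulDr x y z : x ** (y + z) = x ** y + x ** z.
Proof. exact: linearDr. Qed.

End JordanTheory.

Definition jordan_iso (k : fieldType) (J K : jordanType k) : Prop :=
  exists f : {linear J -> K}, bijective f /\ {morph f : x y / x ** y}.

Notation "J ~=j K" := (jordan_iso J K) : ring_scope.

HB.mixin Record isJmulClosed (k : fieldType) (J : jordanType k)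
    (S : {pred J}) := {
  rpredJ : {in S &, forall u v, u ** v \in S}
}.

#[short(type="jordanSubalg")]
HB.structure Definition JordanClosed (k : fieldType) (J : jordanType k) :=
  {S of @GRing.SubmodClosed k J S & isJmulClosed k J S}.

Lemma jsub_rpredB (k : fieldType) (J : jordanType k) (S : jordanSubalg J) :
  {in S &, forall u v, u - v \in S}.
Proof. by move=> u v Su Sv; rewrite -scaleN1r rpredD ?rpredZ. Qed.

Section SubalgebraType.
Variables (k : fieldType) (J : jordanType k) (S : jordanSubalg J).

Inductive jsub_of : predArgType := JSub u & u \in S.
Definition jsval v := let: JSub u _ := v in u.

HB.instance Definition _ := [isSub of jsub_of for jsval].
HB.instance Definition _ := [Choice of jsub_of by <:].
HB.instance Definition _ := GRing.SubChoice_isSubLmodule.Build k J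
  (fun u => u \in S) jsub_of (GRing.subsemimodClosedP S).

Lemma jsvalP (u : jsub_of) : val u \in S.
Proof. exact: valP. Qed.

Definition jsub_mul (u v : jsub_of) : jsub_of :=
  JSub (rpredJ (val u) (val v) (jsvalP u) (jsvalP v)).

Fact jsub_mul_bilinear : bilinear_for *:%R *:%R jsub_mul.
Proof.
split=> [u c v w|u c v w]; apply: val_inj => /=.
  by rewrite linearPl.
by rewrite linearPr.
Qed.

Fact jsub_mulC : commutative jsub_mul.
Proof. by move=> u v; apply: val_inj; rewrite /= jmulC. Qed.

Fact jsub_mul_jordan (a b : jsub_of) :
  jsub_mul (jsub_mul (jsub_mul a a) b) a
  = jsub_mul (jsub_mul a a) (jsub_mul b a).
Proof. by apply: val_inj; rewrite /= jmul_jordan. Qed.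

HB.instance Definition _ :=
  isJordan.Build k jsub_of jsub_mul_bilinear jsub_mulC jsub_mul_jordan.

Lemma val_jmul (u v : jsub_of) : val (u ** v) = val u ** val v.
Proof. by []. Qed.

End SubalgebraType.

Definition is_complement (k : fieldType) (E : jordanType k)
    (A B : jordanSubalg E) : Prop :=
  (forall e : E, exists a b, [/\ a \in A, b \in B & e = a + b]) /\
  (forall e : E, e \in A -> e \in B -> e = 0).

Section MatchedPair.
Variables (k : fieldType) (E : jordanType k) (A B : jordanSubalg E).
Hypothesis AB : is_complement A B.

Fact complement_ex (e : E) : exists a : jsub_of A, e - val a \in B.
Proof.
have [a [b [Aa Bb ->]]] := AB.1 e.
by exists (JSub Aa); rewrite /= addrC addKr.
Qed.

(* The two components of e in E = A (+) B; they are unique by compl_projP. *)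
Definition proj_sub (e : E) : jsub_of A := xchoose (complement_ex e).
Definition proj_compl (e : E) : jsub_of B := JSub (xchooseP (complement_ex e)).

Lemma compl_projE (e : E) : e = val (proj_sub e) + val (proj_compl e).
Proof. by rewrite /= addrC subrK. Qed.

Lemma compl_projP (a : jsub_of A) (b : jsub_of B) :
  proj_sub (val a + val b) = a /\ proj_compl (val a + val b) = b.
Proof.
set e := val a + val b.
have eqv : val (proj_sub e) - val a = val b - val (proj_compl e).
  apply/eqP; rewrite subr_eq addrAC -subr_eq opprK -compl_projE /e.
  by rewrite addrC.
have z : val (proj_sub e) - val a = 0.
  by apply: AB.2; [|rewrite eqv]; apply: jsub_rpredB; apply: jsvalP.
split; apply: val_inj; apply/eqP; rewrite -subr_eq0; first by rewrite z.
by rewrite -oppr_eq0 opprB -eqv z.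
Qed.

Lemma proj_sub_linear : linear proj_sub.
Proof.
move=> c u v; have := compl_projP (c *: proj_sub u + proj_sub v)
  (c *: proj_compl u + proj_compl v).
rewrite !linearP /= addrACA -scalerDr -/(val (proj_compl u)).
by rewrite ![val _ + (_ - _)]addrC !subrK => -[].
Qed.

Lemma proj_compl_linear : linear proj_compl.
Proof.
move=> c u v; have := compl_projP (c *: proj_sub u + proj_sub v)
  (c *: proj_compl u + proj_compl v).
rewrite !linearP /= addrACA -scalerDr.
by rewrite ![val _ + (_ - _)]addrC !subrK => -[].
Qed.

HB.instance Definition _ :=
  GRing.isLinear.Build k E (jsub_of A) *:%R proj_sub proj_sub_linear.
HB.instance Definition _ :=
  GRing.isLinear.Build k E (jsub_of B) *:%R proj_compl proj_compl_linear.

Definition lact (b : jsub_of B) (a : jsub_of A) : jsub_of A :=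
  proj_sub (val b ** val a).
Definition ract (b : jsub_of B) (a : jsub_of A) : jsub_of B :=
  proj_compl (val b ** val a).

Lemma matched_pairE (b : jsub_of B) (a : jsub_of A) :
  val b ** val a = val (lact b a) + val (ract b a).
Proof. exact: compl_projE. Qed.

Fact lact_bilinear : bilinear_for *:%R *:%R lact.
Proof.
split=> [u c v w|u c v w]; rewrite /lact linearP /=.
  by rewrite linearPl linearP.
by rewrite linearPr linearP.
Qed.

Fact ract_bilinear : bilinear_for *:%R *:%R ract.
Proof.
split=> [u c v w|u c v w]; rewrite /ract linearP /=.
  by rewrite linearPl linearP.
by rewrite linearPr linearP.
Qed.

HB.instance Definition _ := bilinear_isBilinear.Build k
  (jsub_of B) (jsub_of A) (jsub_of A) *:%R *:%R lact lact_bilinear.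
HB.instance Definition _ := bilinear_isBilinear.Build k
  (jsub_of B) (jsub_of A) (jsub_of B) *:%R *:%R ract ract_bilinear.

Definition is_deformation_map (r : {linear jsub_of B -> jsub_of A}) : Prop :=
  forall x y : jsub_of B,
    r (x ** y) - r x ** r y =
    lact x (r y) + lact y (r x) - r (ract x (r y) + ract y (r x)).

Section Deformation.
Variable r : {linear jsub_of B -> jsub_of A}.
Hypothesis rP : is_deformation_map r.

(* An alias of the vector space B, indexed by the proof that r is a deformation
   map because the deformed product is a Jordan product only for such r. *)
Definition deformation (_ : is_deformation_map r) : Type := jsub_of B.
Local Notation Br := (deformation rP).

HB.instance Definition _ := GRing.Lmodule.on Br.

Definition deform_mul (x y : Br) : Br :=
  (x : jsub_of B) ** y + ract x (r y) + ract y (r x).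

(* x |-> r x + x embeds B_r in E, whence B_r is a Jordan algebra. *)
Let graph (x : jsub_of B) : E := val (r x) + val x.

Let graph_inj : injective graph.
Proof.
move=> x y /(congr1 proj_compl).
by rewrite (compl_projP (r x) x).2 (compl_projP (r y) y).2.
Qed.

Fact deform_graphM (x y : Br) : graph (deform_mul x y) = graph x ** graph y.
Proof.
have rE : r (deform_mul x y) = r x ** r y + lact x (r y) + lact y (r x).
  rewrite /deform_mul -addrA raddfD /=.
  move/eqP: (rP x y); rewrite subr_eq => /eqP ->.
  by rewrite addrAC subrK addrC addrA.
rewrite /graph jmulDl !jmulDr [val (r x) ** val y]jmulC !matched_pairE.
rewrite rE.
have vD S (u v : @jsub_of k E S) : val (u + v) = val u + val v by [].
by rewrite !vD !val_jmul [RHS](AC ((1*2)*3) ((1*4*2)*(6*5*3))).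
Qed.

Fact deform_mulC : commutative deform_mul.
Proof. by move=> x y; rewrite /deform_mul jmulC addrAC. Qed.

Fact deform_mul_bilinear : bilinear_for *:%R *:%R deform_mul.
Proof.
have linl (u : Br) : linear (deform_mul^~ u).
  move=> c v w; rewrite /deform_mul linearPl.
  have -> : r (c *: v + w) = c *: r v + r w by exact: linearP.
  rewrite (ract_bilinear.1 (r u) c v w) (ract_bilinear.2 u c (r v) (r w)) !scalerDr.
  by rewrite [RHS]addrACA; congr (_ + _); apply: addrACA.
split=> // u c v w; rewrite !(deform_mulC u); exact: linl.
Qed.

Fact deform_mul_jordan (a b : Br) :
  deform_mul (deform_mul (deform_mul a a) b) a
  = deform_mul (deform_mul a a) (deform_mul b a).
Proof. by apply: graph_inj; rewrite !deform_graphM jmul_jordan. Qed.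

HB.instance Definition _ :=
  isJordan.Build k Br deform_mul_bilinear deform_mulC deform_mul_jordan.

End Deformation.
End MatchedPair.

(* Main.v *)
(** An A-complement C of E is the graph of a unique linear map r : B -> A: the
    projection of E onto B along A restricts to a bijection C -> B, and r is the
    A-component of its inverse.  The graph of r is closed under the product of E
    exactly when r is a deformation map, and the projection then transports the
    product of C to that of B_r. *)
Require Import Defs.
From HB Require Import structures.
From mathcomp Require Import all_boot all_order all_algebra.
Set Implicit Arguments.
Unset Strict Implicit.
Unset Printing Implicit Defensive.
Import GRing.Theory.
Local Open Scope ring_scope.

Section Graph.
Variables (k : fieldType) (E : jordanType k) (A B : jordanSubalg E).
Hypothesis AB : is_complement A B.
Variable r : {linear jsub_of B -> jsub_of A}.

Definition graph (x : jsub_of B) : E := val (r x) + val x.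

Lemma proj_sub_graph x : proj_sub AB (graph x) = r x.
Proof. exact: (compl_projP AB (r x) x).1. Qed.

Lemma proj_compl_graph x : proj_compl AB (graph x) = x.
Proof. exact: (compl_projP AB (r x) x).2. Qed.

(** Each mixed product splits into its [A]- and [B]-parts by the matched pair. The [B]-part is the
    product of [B_r], written out because [r] is still an arbitrary linear map here. *)
Lemma graph_jmul x y :
  graph x ** graph y
  = val (r x ** r y + lact AB x (r y) + lact AB y (r x))
    + val (x ** y + ract AB x (r y) + ract AB y (r x)).
Proof.
rewrite /graph jmulDl !jmulDr [val (r x) ** val y]jmulC !(matched_pairE AB).
have vD S (u v : @jsub_of k E S) : val (u + v) = val u + val v by [].
by rewrite !vD !val_jmul [LHS](AC ((1*2)*(2*1)) ((1*4*2)*(6*5*3))).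
Qed.

(** By [graph_jmul], the right-hand side says that the graph of [r] is closed under the product of
    [E]. *)
Lemma deformation_mapP :
  is_deformation_map AB r <->
  forall x y : jsub_of B,
    r (x ** y + ract AB x (r y) + ract AB y (r x))
    = r x ** r y + lact AB x (r y) + lact AB y (r x).
Proof.
have crossE (V : zmodType) (m q l s : V) : (m - q == l - s) = (m + s == q + l).
  by rewrite subr_eq addrAC eq_sym subr_eq eq_sym [q + l]addrC.
split=> rP x y; apply/eqP; move/eqP: (rP x y);
  by rewrite crossE -raddfD !addrA.
Qed.

(** The image of [graph], given by an equation between components so that membership is boolean. *)
Definition graph_pred : {pred E} :=
  [pred e | proj_sub AB e == r (proj_compl AB e)].

Lemma graph_predP e : reflect (e = graph (proj_compl AB e)) (e \in graph_pred).
Proof.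
apply: (iffP eqP) => [re|->]; first by rewrite {1}(compl_projE AB e) re.
by rewrite proj_sub_graph proj_compl_graph.
Qed.

Lemma mem_graph x : graph x \in graph_pred.
Proof. by apply/graph_predP; rewrite proj_compl_graph. Qed.

Fact graph_submod_closed : GRing.submod_closed graph_pred.
Proof.
split=> [|c u v]; rewrite !inE; first by rewrite !linear0.
by move=> /eqP ru /eqP rv; rewrite !linearP /= ru rv.
Qed.

HB.instance Definition _ :=
  GRing.isSubmodClosed.Build k E graph_pred graph_submod_closed.

Hypothesis rP : is_deformation_map AB r.

Fact graph_pred_jmul : {in graph_pred &, forall u v, u ** v \in graph_pred}.
Proof.
move=> u v /graph_predP -> /graph_predP ->.
by rewrite graph_jmul -(deformation_mapP.1 rP) mem_graph.
Qed.

Definition graph_subalg : jordanSubalg E :=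
  HB.pack graph_pred (isJmulClosed.Build k E graph_pred graph_pred_jmul).

Lemma graph_complement : is_complement A graph_subalg.
Proof.
split=> [e|e Ae /graph_predP eC].
  (* With [a] and [b] the components of [e], write [a + b = (a - r b) + (r b + b)]. *)
  exists (val (proj_sub AB e - r (proj_compl AB e))), (graph (proj_compl AB e)).
  split; [exact: jsvalP|exact: mem_graph|].
  by rewrite {1}(compl_projE AB e) /graph linearB subrKA.
(* An element of [A] has zero [B]-component, and the graph point over 0 is 0. *)
have [_] := compl_projP AB (JSub Ae) 0; rewrite /= addr0 => p0.
by rewrite eC p0 /graph linear0 addr0.
Qed.

Lemma deformation_iso_graph : deformation rP ~=j jsub_of graph_subalg.
Proof.
pose f (x : deformation rP) : jsub_of graph_subalg :=
    @JSub k E graph_subalg (graph x) (mem_graph x).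
have lin_f : linear f.
  move=> c x y; apply: val_inj.
  rewrite /= /graph linearP /=.
  by rewrite scalerDr; apply: addrACA.
pose lf : {linear deformation rP -> jsub_of graph_subalg} :=
  HB.pack f (GRing.isLinear.Build k _ _ _ f lin_f).
exists lf; split=> [|x y]; last first.
  apply: val_inj; exact: deform_graphM.
exists (fun c => proj_compl AB (val c)) => [x|[c Cc]].
  exact: proj_compl_graph.
by apply: val_inj; rewrite /= -(graph_predP _ Cc).
Qed.

End Graph.

Section ComplementToDeformation.
Variables (k : fieldType) (E : jordanType k) (A B C : jordanSubalg E).
Hypotheses (AB : is_complement A B) (AC : is_complement A C).

(* The graph of this map sends b to its C-component in E = A (+) C. *)
Definition complement_map (b : jsub_of B) : jsub_of A :=
  - proj_sub AC (val b).

Fact complement_map_linear : linear complement_map.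
Proof.
by move=> c u v; rewrite /complement_map !linearP.
Qed.

HB.instance Definition _ := GRing.isLinear.Build k _ _ _
  complement_map complement_map_linear.

Local Notation r := (complement_map : {linear _ -> _}).

Lemma graph_complement_map b : graph r b = val (proj_compl AC (val b)).
Proof.
rewrite /graph [X in _ + X = _](compl_projE AC).
by rewrite addrA [val (r b)]linearN addNr add0r.
Qed.

(** Projecting to [A] along [C] kills [a + b] and fixes [a], so [a] is minus the projection of [b].
    Thus [C] has no points off the graph of [r]. *)
Lemma mem_complementE (a : jsub_of A) (b : jsub_of B) :
  val a + val b \in C -> a = r b.
Proof.
move=> Cab; have := compl_projP AC 0 (JSub Cab).
rewrite /= add0r => -[+ _]; rewrite linearD /= => pab.
have [pa _] := compl_projP AC a 0.
move: pab; rewrite -[val a]addr0 pa => /eqP.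
by rewrite addr_eq0 => /eqP.
Qed.

(** Graph points lie in [C], hence so do their products, and [mem_complementE] relates the two
    components of such a product. *)
Lemma complement_map_deformation : is_deformation_map AB r.
Proof.
apply/deformation_mapP => x y; symmetry; apply: mem_complementE.
rewrite -graph_jmul; apply: rpredJ; rewrite graph_complement_map; exact: jsvalP.
Qed.

Lemma complement_iso_deformation :
  jsub_of C ~=j deformation complement_map_deformation.
Proof.
pose f (c : jsub_of C) : deformation complement_map_deformation :=
  proj_compl AB (val c).
have lin_f : linear f by move=> a u v; rewrite /f !linearP.
pose lf : {linear jsub_of C -> deformation complement_map_deformation} :=
  HB.pack f (GRing.isLinear.Build k _ _ _ f lin_f).
(* Every [c] in [C] is the graph point over its [B]-component, so projection to [C] along [A] will
   invert [f]. *)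
have fE c : graph r (f c) = val c.
  rewrite [RHS](compl_projE AB (val c)) /graph.
  rewrite -(@mem_complementE (proj_sub AB (val c)) (proj_compl AB (val c))) //.
  by rewrite -compl_projE; exact: jsvalP.
exists lf; split=> [|c d].
  exists (fun b => proj_compl AC (val b)) => [c|b].
    by apply: val_inj; rewrite -graph_complement_map fE.
  by rewrite /= /f -graph_complement_map proj_compl_graph.
(* Multiplicativity of [f] is that of [graph], read through the projection to [B]. *)
rewrite -[LHS](proj_compl_graph AB r) fE val_jmul -!fE.
by rewrite -(deform_graphM (rP := complement_map_deformation)) proj_compl_graph.
Qed.

End ComplementToDeformation.

Lemma jordan_iso_trans (k : fieldType) (J K L : jordanType k) :
  J ~=j K -> K ~=j L -> J ~=j L.
Proof.
move=> [f [bij_f fM]] [g [bij_g gM]]; exists (g \o f : {linear J -> L}).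
by split=> [|x y]; [exact: bij_comp|rewrite /= fM gM].
Qed.

(** As [Bbar] is an abstract algebra, being a complement means being isomorphic to a subalgebra of
    [E] that is one. *)
Theorem theorem3p4 (k : fieldType) (char_k : 2%N \notin [pchar k])
    (E : jordanType k) (A B : jordanSubalg E) (AB : is_complement A B)
    (Bbar : jordanType k) :
  (exists C : jordanSubalg E, is_complement A C /\ Bbar ~=j jsub_of C)
  <->
  (exists (r : {linear jsub_of B -> jsub_of A})
          (rP : is_deformation_map AB r), Bbar ~=j deformation rP).
Proof.
split=> [[C [AC isoC]]|[r [rP isoB]]].
  exists _, (complement_map_deformation AB AC).
  exact: jordan_iso_trans isoC (complement_iso_deformation AB AC).
exists (graph_subalg rP); split; first exact: graph_complement.
exact: jordan_iso_trans isoB (deformation_iso_graph rP).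
Qed.
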